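(* Let $\{s_k\}_{k\in\mathbb{N}_0}$ be a positive sequence, let $d\in\mathbb{N}$ (so $d\ge 1$) and $\ell_0\in 2\mathbb{N}_0$, and let $\{\tilde s_k\}_{k\in\mathbb{N}_0}$ be given by $\tilde s_k=s_{kd+\ell_0}$. If $\{s_k\}$ is indeterminate, then $\{\tilde s_k\}$ is indeterminate. Equivalently, if $\{\tilde s_k\}$ is determinate, then $\{s_k\}$ is determinate.
   Context: A sequence of real numbers $\{s_k\}_{k\in\mathbb{N}_0}$ is called positive if for every $n$ the Hankel matrix $(s_{i+j})_{i,j=0}^n$ is positive semidefinite; equivalently there exists a non-decreasing function $\sigma$ on $\mathbb{R}$ (a moment solution) with $s_k=\int_{-\infty}^\infty x^k\,d\sigma(x)$ for all $k\in\mathbb{N}_0$. Two non-decreasing functions are not considered distinct if their difference is constant at all points of continuity of the difference. A positive sequence is determinate if it has exactly one moment solution (in this sense), and indeterminate otherwise. (It is known, by a theorem of Berg–Chen–Ismail, that a positive sequence is determinate iff the smallest eigenvalue of $(s_{i+j})_{i,j=0}^n$ tends to $0$ as $n\to\infty$.) *)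

(* Defs.v *)
From Stdlib Require Import Reals Lra Lia.
Open Scope R_scope.

Fixpoint rsum (g : nat -> R) (n : nat) : R :=
  match n with O => 0 | S m => rsum g m + g m end.

(* A sequence is positive iff every Hankel matrix (s_{i+j})_{i,j=0}^n is
   positive semidefinite (quadratic form written out). *)
Definition positive_seq (s : nat -> R) : Prop :=
  forall (n : nat) (c : nat -> R),
    0 <= rsum (fun i => rsum (fun j => c i * c j * s (i + j)%nat) (S n)) (S n).

Definition nondecreasing (sigma : R -> R) : Prop :=
  forall x y, x <= y -> sigma x <= sigma y.

Definition tagged_partition (a b : R) (n : nat) (p t : nat -> R) : Prop :=
  p O = a /\ p n = b /\
  (forall i, (i < n)%nat -> p i < p (S i)) /\
  (forall i, (i < n)%nat -> p i <= t i <= p (S i)).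

Definition mesh_lt (n : nat) (p : nat -> R) (delta : R) : Prop :=
  forall i, (i < n)%nat -> p (S i) - p i < delta.

Definition RS_sum (f sigma : R -> R) (n : nat) (p t : nat -> R) : R :=
  rsum (fun i => f (t i) * (sigma (p (S i)) - sigma (p i))) n.

Definition RS_integral (f sigma : R -> R) (a b I : R) : Prop :=
  forall eps, 0 < eps -> exists delta, 0 < delta /\
    forall n p t, tagged_partition a b n p t -> mesh_lt n p delta ->
      Rabs (RS_sum f sigma n p t - I) < eps.

Definition RS_integral_R (f sigma : R -> R) (I : R) : Prop :=
  forall eps, 0 < eps -> exists M, forall a b, a <= - M -> M <= b ->
    exists J, RS_integral f sigma a b J /\ Rabs (J - I) < eps.

Definition moment_solution (s : nat -> R) (sigma : R -> R) : Prop :=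
  nondecreasing sigma /\ forall k, RS_integral_R (fun x => x ^ k) sigma (s k).

Definition same_solution (s1 s2 : R -> R) : Prop :=
  exists c, forall x, continuity_pt (fun y => s1 y - s2 y) x -> s1 x - s2 x = c.

Definition determinate (s : nat -> R) : Prop :=
  positive_seq s /\
  (exists sigma, moment_solution s sigma) /\
  (forall s1 s2, moment_solution s s1 -> moment_solution s s2 -> same_solution s1 s2).

Definition indeterminate (s : nat -> R) : Prop :=
  positive_seq s /\ ~ determinate s.

(* Main.v *)
(* Let [L] be the functional on polynomials with [L (X ^ k) = s k].

   Chebyshev-Markov-Stieltjes.  If [p] is a polynomial with [p(t) = 1], there are
   polynomials [V <= 1_(-oo, t[ <= 1_(-oo, t] <= U] with [U - V <= p ^ 2]: first replace
   [p] by a real-rooted polynomial of smaller modulus and with the same value at [t], then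
   take for [U] and [V] Hermite interpolants of the step at the double roots.  Hence, if
   the evaluation at [t] is not bounded by [c p(t) ^ 2 <= L (p ^ 2)] for any [c > 0], all
   solutions, normalised at [-oo], agree at [t].  So the solution is unique as soon as
   evaluation is bounded at countably many points only.

   If evaluation is bounded at [t] by [c], then removing an atom of mass [c] at [t] leaves
   a positive functional; by Hamburger's theorem some solution has an atom at [t].  For a
   determinate sequence, these points are therefore discontinuities of its solution, and
   there are countably many of them.

   Applied to [X ^ (l0 / 2) q (X ^ d)], the bound at [t <> 0] for [s] becomes a bound at
   [t ^ d] for the sequence [s (k d + l0)].  If the latter is determinate, evaluation for
   [s] is bounded at countably many points only.

   Hamburger's theorem itself is obtained by extending [L], by the theorem of M. Riesz, to
   a positive functional on all functions of polynomial growth and evaluating it on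
   indicators of half-lines. *)
From HB Require Import structures.
From Corelib Require Import ssreflect ssrbool.
From Stdlib Require Import Reals.
Require Import Defs.
From mathcomp Require all_boot all_order all_algebra complex polyrcf ring lra.
From mathcomp Require boolp classical_sets functions cardinality reals.
From mathcomp Require topology normedtype sequences Rstruct.

Module RealPolynomials.

Import all_boot all_order all_algebra complex polyrcf ring lra.
Import Order.TTheory GRing.Theory Num.Theory.
Set Implicit Arguments. Unset Strict Implicit. Unset Printing Implicit Defensive.
Local Open Scope ring_scope.

Section NodePolynomials.
Variable R : fieldType.
Implicit Types (zs bs : seq R).

Definition node_poly zs : {poly R} := \prod_(z <- zs) ('X - z%:P).

Definition conode_poly bs : {poly R} := \prod_(b <- bs) (b%:P - 'X).

Lemma conode_polyE bs : conode_poly bs = (-1) ^+ size bs *: node_poly bs.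
Proof.
rewrite /conode_poly /node_poly; elim: bs => [|b bs IHb].
  by rewrite !big_nil scale1r.
by rewrite !big_cons IHb -opprB mulNr -scalerAr exprS mulN1r scaleNr.
Qed.

Lemma conode_poly_sqr bs : conode_poly bs ^+ 2 = node_poly bs ^+ 2.
Proof.
by rewrite conode_polyE exprZn -exprM mulnC exprM sqrrN expr1n expr1n scale1r.
Qed.

Lemma size_node_mul_conode zs bs :
  size (node_poly zs * conode_poly bs) = (size zs + size bs).+1.
Proof.
rewrite conode_polyE -scalerAr size_scale ?signr_eq0 //.
by rewrite /node_poly -big_cat size_prod_XsubC size_cat.
Qed.

Lemma coprimep_node_conode zs bs :
  {in bs, forall b, b \notin zs} -> coprimep (node_poly zs) (conode_poly bs).
Proof.
move=> zb; rewrite conode_polyE coprimepZr ?signr_eq0 // [node_poly bs]/node_poly.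
rewrite big_seq; elim/big_rec: _ => [|b q /zb b_zs zs_q]; first exact: coprimep1.
by rewrite coprimepMr coprimep_XsubC root_prod_XsubC b_zs.
Qed.

End NodePolynomials.

Section Factorization.
Variable R : rcfType.
Implicit Types (p q d : {poly R}) (a b t : R).

Definition quadratic a b : {poly R} := ('X - a%:P) ^+ 2 + (b ^+ 2)%:P.

Lemma horner_quadratic a b x : (quadratic a b).[x] = (x - a) ^+ 2 + b ^+ 2.
Proof. by rewrite /quadratic !hornerE. Qed.

Lemma size_quadratic a b : size (quadratic a b) = 3%N.
Proof.
rewrite /quadratic size_polyDl size_exp_XsubC //.
by rewrite (leq_ltn_trans (size_polyC_leq1 _)).
Qed.

Inductive real_factor : {poly R} -> Prop :=
  | LinearFactor a : real_factor ('X - a%:P)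
  | QuadraticFactor a b of b != 0 : real_factor (quadratic a b).

Lemma real_factor_size d : real_factor d -> (1 < size d)%N.
Proof. by case=> [a|a b _]; rewrite ?size_XsubC ?size_quadratic. Qed.

Local Notation toC := (map_poly (real_complex R)).

Lemma complex_root_quadratic_dvdp p a b :
  b != 0 -> root (toC p) (Complex a b) -> quadratic a b %| p.
Proof.
move=> b0 rz; set d := quadratic a b.
have dz : (toC d).[Complex a b] = 0.
  rewrite /d rmorphD rmorphXn rmorphB /= map_polyX !map_polyC !hornerE /=.
  rewrite expr2 /=; simpc; apply/eqP; rewrite eq_complex /=.
  by apply/andP; split; apply/eqP; ring.
have : (toC (p %% d)).[Complex a b] = 0.
  move/eqP: rz; rewrite {1}(divp_eq p d) rmorphD rmorphM /= hornerD hornerM.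
  by rewrite dz mulr0 add0r.
have rE : p %% d = (p %% d)`_1 *: 'X + ((p %% d)`_0)%:P.
  have : (size (p %% d)%R < 3)%N.
    by rewrite -(size_quadratic a b) ltn_modp -size_poly_gt0 size_quadratic.
  rewrite ltnS => sr; apply/polyP => -[|[|i]];
    rewrite !coefE /= ?mulr0 ?add0r ?mulr1 ?addr0 // nth_default //.
  exact: leq_trans sr _.
rewrite rE rmorphD /= map_polyZ map_polyX map_polyC !hornerE /=.
simpc => /eqP; rewrite eq_complex /= mulf_eq0 (negbTE b0) orbF.
case/andP=> + /eqP r1; rewrite r1 mul0r add0r => /eqP r0.
by rewrite /dvdp rE r1 r0 scale0r addr0.
Qed.

Lemma real_poly_factor p : (1 < size p)%N ->
  exists d q, [/\ real_factor d, p = q * d & (size q < size p)%N].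
Proof.
move=> sp; have p0 : p != 0 by rewrite -size_poly_gt0 ltnW.
suff [d dF /dvdpP[q pE]] : exists2 d, real_factor d & d %| p.
  exists d, q; split=> //; rewrite pE.
  have [q0 d0] : q != 0 /\ d != 0 by apply/andP; rewrite -negb_or -mulf_eq0 -pE.
  rewrite size_mul // -[ltnLHS]addn0 -subn1 -addnBA ?size_poly_gt0 //.
  by rewrite ltn_add2l subn_gt0 real_factor_size.
have /closed_rootP[[a b] rz] : size (toC p) != 1%N.
  by rewrite size_map_poly neq_ltn sp orbT.
have [b0|b0] := eqVneq b 0; last first.
  by exists (quadratic a b); [exact: QuadraticFactor|exact: complex_root_quadratic_dvdp].
exists ('X - a%:P); first exact: LinearFactor.
move: rz; rewrite b0 complexr0 -root_factor_theorem /root horner_map /=.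
by rewrite fmorph_eq0.
Qed.

Lemma real_poly_ind (P : {poly R} -> Prop) :
  (forall c, P c%:P) -> (forall d, real_factor d -> P d) ->
  (forall p q, P p -> P q -> P (p * q)) -> forall p, P p.
Proof.
move=> PC Pd PM p; have [n] := ubnP (size p); elim: n p => // n IHn p /ltnSE sp.
case: (ltnP 1 (size p)) => [/real_poly_factor[d [q [dF pE sq]]]|/size1_polyC -> //].
by rewrite pE; apply: PM (Pd d dF); apply: IHn; apply: leq_trans sp.
Qed.

Lemma horner_ge0_ray p a h :
  (forall e : R, 0 < e -> 0 <= p.[a + h * e]) -> 0 <= p.[a].
Proof.
move=> p_ge0; rewrite leNgt; apply/negP => pa.
pose q := p \Po (a%:P + h *: 'X).
have qE (e : R) : q.[e] = p.[a + h * e] by rewrite horner_comp !hornerE.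
have [|e e0] := @poly_cont _ 0 q (- p.[a]); first by rewrite oppr_gt0.
have [e2 e2e] : 0 < e / 2 /\ e / 2 < e by split; lra.
move=> /(_ (e / 2)); rewrite !qE mulr0 addr0 subr0 gtr0_norm // => /(_ e2e).
by move=> /ltr_normlW; rewrite ltrBlDr addNr ltNge p_ge0.
Qed.

Lemma quadratic_mul_sum_two_squares a b f g : quadratic a b * (f ^+ 2 + g ^+ 2) =
  (('X - a%:P) * f + b%:P * g) ^+ 2 + (('X - a%:P) * g - b%:P * f) ^+ 2.
Proof. by rewrite /quadratic rmorphXn /=; ring. Qed.

Lemma nonneg_quadratic_factor p : (1 < size p)%N -> (forall x, 0 <= p.[x]) ->
  exists a b q, p = quadratic a b * q /\ (size q < size p)%N.
Proof.
move=> sp p_ge0; have [d [q [dF pE sq]]] := real_poly_factor sp.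
case: dF pE => [a|a b _] pE; last by exists a, b, q; rewrite mulrC.
have pxE h e : p.[a + h * e] = q.[a + h * e] * (h * e).
  by rewrite pE hornerM hornerXsubC addrAC subrr add0r.
have /factor_theorem[r qE] : root q a.
  rewrite /root eq_le -oppr_ge0 -hornerN; apply/andP; split.
    apply: (@horner_ge0_ray _ _ (-1)) => e e0; have := p_ge0 (a + -1 * e).
    by rewrite pxE mulN1r mulrN -mulNr -hornerN pmulr_lge0.
  apply: (@horner_ge0_ray _ _ 1) => e e0; have := p_ge0 (a + 1 * e).
  by rewrite pxE mul1r pmulr_lge0.
exists a, 0, r; split; first by rewrite pE qE /quadratic expr0n /= addr0; ring.
have [->|r0] := eqVneq r 0; first by rewrite size_poly0 ltnW.
by apply: leq_ltn_trans sq; rewrite qE size_Mmonic ?monicXsubC // size_XsubC addn2.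
Qed.

Lemma nonneg_sum_two_squares p :
  (forall x, 0 <= p.[x]) -> exists f g : {poly R}, p = f ^+ 2 + g ^+ 2.
Proof.
have [n] := ubnP (size p); elim: n p => // n IHn p /ltnSE sn p_ge0.
case: (ltnP 1 (size p)) => [sp|/size1_polyC pE]; last first.
  exists (Num.sqrt p`_0)%:P, 0; rewrite expr0n addr0 -rmorphXn /= sqr_sqrtr //.
  by have := p_ge0 0; rewrite pE hornerC coefC.
have [a [b [q [pE sq]]]] := nonneg_quadratic_factor sp p_ge0.
have q_ge0 x : x != a -> 0 <= q.[x].
  move=> xa; have := p_ge0 x; rewrite pE hornerM horner_quadratic pmulr_rge0 //.
  by rewrite ltr_wpDr ?sqr_ge0 // lt_def sqr_ge0 expf_eq0 /= subr_eq0 xa.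
have [x|f [g qE]] := IHn q (leq_trans sq sn).
  have [->|/q_ge0 //] := eqVneq x a; apply: (@horner_ge0_ray _ _ 1) => e e0.
  by rewrite q_ge0 // mul1r -subr_eq0 addrAC subrr add0r gt_eqF.
exists (('X - a%:P) * f + b%:P * g), (('X - a%:P) * g - b%:P * f).
by rewrite pE qE quadratic_mul_sum_two_squares.
Qed.

(* For [a] different from [t] the double root is where the tangent at [t] to
   [sqrt (quadratic a b)] meets the axis; the bound is the Cauchy-Schwarz inequality. *)
Lemma quadratic_real_rooted_minorant a b t : b != 0 -> exists2 rs : seq R,
  (node_poly rs).[t] != 0 & forall x, ((quadratic a b).[t] * (node_poly rs).[x]) ^+ 2 <=
    ((quadratic a b).[x] * (node_poly rs).[t]) ^+ 2.
Proof.
move=> b0; have Qpos x : 0 < (quadratic a b).[x].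
  by rewrite horner_quadratic ltr_wpDl ?sqr_ge0 // lt_def sqr_ge0 expf_eq0 b0.
have [ta|ta] := eqVneq t a.
  exists [::] => [|x]; rewrite /node_poly big_nil !hornerC ?oner_eq0 // !mulr1.
  rewrite lerXn2r ?nnegrE ?(ltW (Qpos _)) // !horner_quadratic ta subrr expr0n add0r.
  by rewrite lerDr sqr_ge0.
have ta0 : t - a != 0 by rewrite subr_eq0.
pose r := a - b ^+ 2 / (t - a).
have rE x : (x - r) * (t - a) = (x - a) * (t - a) + b ^+ 2 by rewrite /r; field.
have tr : (t - r) * (t - a) = (quadratic a b).[t] by rewrite rE horner_quadratic.
exists [:: r; r] => [|x];
  rewrite /node_poly !big_cons big_nil mulr1 -expr2 !horner_exp !hornerXsubC.
  rewrite expf_eq0 /=; apply: contraTN (Qpos t) => /eqP tr0.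
  by rewrite -tr tr0 mul0r ltxx.
have Q_ge0 x' y : 0 <= (quadratic a b).[x'] * y ^+ 2.
  by rewrite mulr_ge0 ?sqr_ge0 // ltW.
rewrite lerXn2r ?nnegrE // -(@ler_pM2r _ ((t - a) ^+ 2)); last first.
  by rewrite lt_def sqr_ge0 expf_eq0 ta0.
rewrite -2![_.[_] * _ * _]mulrA -!exprMn tr rE [leLHS]mulrC [in leRHS]expr2 mulrA.
rewrite ler_pM2r // !horner_quadratic -subr_ge0.
have -> : ((x - a) ^+ 2 + b ^+ 2) * ((t - a) ^+ 2 + b ^+ 2)
  - ((x - a) * (t - a) + b ^+ 2) ^+ 2 = (b * (x - t)) ^+ 2 by ring.
exact: sqr_ge0.
Qed.

Lemma real_rooted_minorant p t : p.[t] != 0 -> exists2 rs : seq R,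
  (node_poly rs).[t] != 0 & forall x,
    (p.[t] * (node_poly rs).[x]) ^+ 2 <= (p.[x] * (node_poly rs).[t]) ^+ 2.
Proof.
elim/real_poly_ind: p => [c|_ [a|a b b0]|p q IHp IHq] pt.
- by exists [::] => [|x]; rewrite /node_poly big_nil !hornerC ?oner_eq0.
- exists [:: a] => [|x]; rewrite /node_poly big_cons big_nil mulr1 //.
  by rewrite mulrC.
- exact: quadratic_real_rooted_minorant.
move: pt; rewrite hornerM mulf_eq0 negb_or => /andP[/IHp[rs rst Hp] /IHq[rs' rst' Hq]].
exists (rs ++ rs') => [|x]; rewrite /node_poly big_cat hornerM ?mulf_neq0 //.
rewrite !hornerM mulrACA [in leRHS]mulrACA [leLHS]exprMn [leRHS]exprMn.
by rewrite ler_pM ?sqr_ge0.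
Qed.

End Factorization.
End RealPolynomials.

Module StepMajorants.

Import all_boot all_order all_algebra ring.
Import Order.TTheory GRing.Theory Num.Theory RealPolynomials.
Set Implicit Arguments. Unset Strict Implicit. Unset Printing Implicit Defensive.
Local Open Scope ring_scope.

Section StepInterpolation.
Variable R : realFieldType.
Implicit Types (t x z b : R) (zs bs : seq R).

(* The interpolant of the values [1] at [zs] and [0] at [bs], by Neville's recursion.
   The cofactors [C] and [E] record on which sides it stays above [0] and below [1]. *)
Lemma step_interpolant zs bs : {in zs & bs, forall z b, z < b} ->
  exists H C E : {poly R},
    [/\ (size H <= size zs + size bs)%N, H = conode_poly bs * C,
        1 - H = node_poly zs * E,
        forall x, {in zs, forall z, z <= x} -> 0 <= C.[x] &
        forall x, {in bs, forall b, x <= b} -> 0 <= E.[x]].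
Proof.
elim: zs bs => [|z zs IHz] bs.
  exists 0, 0, 1; rewrite size_poly0 mulr0 /node_poly big_nil subr0 mulr1.
  by split=> // x _; rewrite hornerC.
elim: bs => [|b bs IHb] zb.
  exists 1, 1, 0; rewrite size_poly1 mulr0 /conode_poly big_nil subrr mulr1.
  by split=> // x _; rewrite hornerC.
have zb0 : z < b by rewrite zb ?mem_head.
have [|H1 [C1 [E1 [s1 H1E F1E C1_ge0 E1_ge0]]]] := IHb.
  by move=> y c yz cb; rewrite zb // inE cb orbT.
have [|H2 [C2 [E2 [s2 H2E F2E C2_ge0 E2_ge0]]]] := IHz (b :: bs).
  by move=> y c yz cb; rewrite zb // inE yz orbT.
pose k := (b - z)^-1.
have k_gt0 : 0 < k by rewrite invr_gt0 subr_gt0.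
have kE : k%:P * (b%:P - z%:P) = 1 :> {poly R}.
  by rewrite -polyCB -polyCM mulVf // subr_eq0 gt_eqF.
exists (k%:P * ((b%:P - 'X) * H1 + ('X - z%:P) * H2)), (k%:P * (C1 + ('X - z%:P) * C2)),
  (k%:P * ((b%:P - 'X) * E1 + E2)); split.
- rewrite mul_polyC (leq_trans (size_scale_leq _ _)) // (leq_trans (size_polyD _ _)) //.
  rewrite geq_max !(leq_trans (size_polyMleq _ _)) //.
    by rewrite size_XsubC.
  by rewrite -opprB size_polyN size_XsubC addnS ltnS.
- rewrite H1E H2E /conode_poly big_cons; ring.
- transitivity (k%:P * ((b%:P - 'X) * (1 - H1) + ('X - z%:P) * (1 - H2))).
    by rewrite -{1}kE; ring.
  by rewrite F1E F2E /node_poly big_cons; ring.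
- move=> x zx; rewrite !hornerE mulr_ge0 ?(ltW k_gt0) // addr_ge0 ?C1_ge0 //.
  rewrite mulr_ge0 ?subr_ge0 ?zx ?mem_head // C2_ge0 // => y yz.
  by rewrite zx // inE yz orbT.
- move=> x xb; rewrite !hornerE mulr_ge0 ?(ltW k_gt0) // addr_ge0 ?E2_ge0 //.
  rewrite mulr_ge0 ?subr_ge0 ?xb ?mem_head // E1_ge0 // => y yb.
  by rewrite xb // inE yb orbT.
Qed.

Lemma horner_node_conode_multiple zs bs (p : {poly R}) x t :
  {in zs & bs, forall z b, z < b} -> node_poly zs %| p -> conode_poly bs %| p ->
  (size p <= (size zs + size bs).+1)%N ->
  p.[x] * (node_poly zs * conode_poly bs).[t] =
    p.[t] * (node_poly zs * conode_poly bs).[x].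
Proof.
move=> zb zs_p bs_p sp; set N := node_poly zs * conode_poly bs.
have : N %| p.
  rewrite Gauss_dvdp ?zs_p // coprimep_node_conode // => b bbs.
  by apply/negP => bzs; have := zb b b bzs bbs; rewrite ltxx.
case/dvdpP=> q pE; suff -> : p = (q`_0)%:P * N by rewrite !hornerM !hornerC mulrAC.
rewrite pE; congr (_ * _); apply: size1_polyC; rewrite leqNgt; apply/negP => sq.
have q0 : q != 0 by rewrite -size_poly_gt0 ltnW.
have N0 : N != 0 by rewrite -size_poly_gt0 size_node_mul_conode.
move: sp; rewrite pE size_mul // size_node_mul_conode addnS /= -[leqRHS]add1n leq_add2r.
by rewrite leqNgt sq.
Qed.

Variables (t : R) (zs bs : seq R).
Hypothesis zs_lt : {in zs, forall z, z < t}.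
Hypothesis bs_gt : {in bs, forall b, t < b}.
Hypothesis node_ge0 : forall x, 0 <= (node_poly zs).[x].
Hypothesis conode_ge0 : forall x, 0 <= (conode_poly bs).[x].

Lemma step_majorant : exists U : {poly R},
  [/\ forall x, 0 <= U.[x], forall x, x <= t -> 1 <= U.[x], U.[t] = 1,
      (size U <= (size zs + size bs).+1)%N &
      conode_poly bs %| U /\ node_poly zs %| 1 - U].
Proof.
have [|U [C [E [sU UE FUE C_ge0 E_ge0]]]] := @step_interpolant (t :: zs) bs.
  by move=> z b; rewrite inE => /predU1P[->|/zs_lt zt] /bs_gt //; exact: lt_trans.
move: FUE; rewrite /node_poly big_cons -/(node_poly zs) -mulrA => FUE.
have FUx x : U.[x] = 1 - (x - t) * ((node_poly zs).[x] * E.[x]).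
  have := congr1 (horner^~ x) FUE.
  by rewrite /= 2!hornerM hornerXsubC hornerD hornerN hornerC => <-; rewrite subKr.
have U_ge1 x : x <= t -> 1 <= U.[x].
  move=> xt; rewrite FUx lerDl oppr_ge0 mulr_le0_ge0 ?subr_le0 // mulr_ge0 // E_ge0 // => b.
  by move/bs_gt/(le_lt_trans xt)/ltW.
exists U; split=> //; last by rewrite FUE UE dvdp_mulr // dvdp_mull // dvdp_mulr.
- move=> x; case: (leP x t) => [/U_ge1|/ltW tx]; first exact: le_trans.
  rewrite UE hornerM mulr_ge0 // C_ge0 // => z; rewrite inE.
  by case/predU1P=> [-> //|/zs_lt/ltW zt]; exact: le_trans tx.
- by rewrite FUx subrr mul0r subr0.
Qed.

Lemma step_minorant : exists V : {poly R},
  [/\ forall x, V.[x] <= 1, forall x, t <= x -> V.[x] <= 0, V.[t] = 0,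
      (size V <= (size zs + size bs).+1)%N &
      conode_poly bs %| V /\ node_poly zs %| 1 - V].
Proof.
have [|V [C [E [sV VE FVE C_ge0 E_ge0]]]] := @step_interpolant zs (t :: bs).
  by move=> z b /zs_lt zt; rewrite inE => /predU1P[-> //|/bs_gt]; exact: lt_trans.
move: VE; rewrite /conode_poly big_cons -/(conode_poly bs) -mulrA => VE.
have Vx x : V.[x] = (t - x) * ((conode_poly bs).[x] * C.[x]).
  by rewrite VE !hornerM hornerD hornerN hornerC hornerX.
have V_le0 x : t <= x -> V.[x] <= 0.
  move=> tx; rewrite Vx mulr_le0_ge0 ?subr_le0 // mulr_ge0 // C_ge0 // => z.
  by move=> /zs_lt/ltW zt; exact: le_trans tx.
exists V; split=> //; last by rewrite FVE VE dvdp_mull ?dvdp_mulr.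
- move=> x; case: (leP t x) => [/V_le0/le_trans|/ltW xt]; first exact.
  rewrite -subr_ge0 -[1](hornerC _ x) -hornerN -hornerD FVE hornerM mulr_ge0 //.
  rewrite E_ge0 // => b; rewrite inE.
  by case/predU1P=> [-> //|/bs_gt/ltW]; exact: le_trans xt.
- by rewrite Vx subrr mul0r.
- by rewrite addnS in sV.
Qed.

End StepInterpolation.

Lemma chebyshev_markov_stieltjes (R : rcfType) (p : {poly R}) (t : R) : p.[t] != 0 ->
  exists U V : {poly R},
    [/\ forall x, 0 <= U.[x], forall x, x <= t -> 1 <= U.[x],
        forall x, V.[x] <= 1, forall x, t <= x -> V.[x] <= 0 &
        forall x, p.[t] ^+ 2 * (U - V).[x] <= p.[x] ^+ 2].
Proof.
move=> pt; have [rs rst p_min] := real_rooted_minorant pt.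
pose zs := [seq r <- rs | r < t]; pose bs := [seq r <- rs | ~~ (r < t)].
have nodesE : node_poly (zs ++ zs) * conode_poly (bs ++ bs) = node_poly rs ^+ 2.
  rewrite /node_poly /conode_poly !big_cat /= -!expr2 -!/(conode_poly bs).
  rewrite conode_poly_sqr -exprMn /node_poly !big_filter.
  by rewrite [in RHS](bigID (fun r => r < t)).
have cat_ge0 (F : R -> {poly R}) s x : 0 <= (\prod_(r <- s ++ s) F r).[x].
  by rewrite big_cat hornerM -expr2 sqr_ge0.
have zt : {in zs ++ zs, forall z, z < t}.
  by move=> z; rewrite mem_cat orbb mem_filter => /andP[].
have tb : {in bs ++ bs, forall b, t < b}.
  move=> b; rewrite mem_cat orbb mem_filter -leNgt le_eqVlt => /andP[+ brs].
  by case/orP=> // /eqP tb; move: rst; rewrite tb -rootE root_prod_XsubC brs.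
have [U [U0 U1 Ut sU [bs_U zs_U]]] := step_majorant zt tb (cat_ge0 _ _) (cat_ge0 _ _).
have [V [V1 V0 Vt sV [bs_V zs_V]]] := step_minorant zt tb (cat_ge0 _ _) (cat_ge0 _ _).
exists U, V; split=> // x.
have N2 : 0 < (node_poly rs).[t] ^+ 2 by rewrite lt_def sqr_ge0 expf_eq0 rst.
rewrite -(ler_pM2r N2) -[leRHS]exprMn -mulrA.
rewrite -[(node_poly rs).[t] ^+ 2]horner_exp -nodesE.
rewrite (@horner_node_conode_multiple _ _ _ _ x t).
- rewrite hornerD hornerN Ut Vt subr0 mul1r nodesE horner_exp -!exprMn.
  exact: p_min.
- by move=> z b /zt zt' /tb; exact: lt_trans.
- have -> : U - V = (1 - V) - (1 - U) by ring.
  by rewrite dvdp_sub.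
- by rewrite dvdp_sub.
- by rewrite (leq_trans (size_polyD _ _)) // geq_max size_polyN sU.
Qed.

End StepMajorants.

Module ExtensionTheorems.

Import all_boot all_order all_algebra boolp classical_sets reals lra.
Import Order.TTheory GRing.Theory Num.Theory.
Set Implicit Arguments. Unset Strict Implicit. Unset Printing Implicit Defensive.
Local Open Scope ring_scope.
Local Open Scope classical_set_scope.

Definition scalar_pack (R : nzRingType) (V : lmodType R) (f : V -> R)
    (f_scalar : scalar f) : {scalar V} :=
  HB.pack_for {scalar V} f (GRing.isLinear.Build _ _ _ _ f f_scalar).

Lemma scalar_packE (R : nzRingType) (V : lmodType R) (f : V -> R) (f_scalar : scalar f) x :
  scalar_pack f_scalar x = f x.
Proof. by []. Qed.

Section HahnBanach.
Variables (R : realType) (V : lmodType R).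
Implicit Types (p q : V -> R) (x y : V) (a t : R).

Definition sublinear q := (forall x y, q (x + y) <= q x + q y) /\
  (forall a x, 0 < a -> q (a *: x) = a * q x).

Lemma sublinear0 q : sublinear q -> q 0 = 0.
Proof. by move=> [_ /(_ 2 0 (ltr0n _ 2))]; rewrite scaler0; lra. Qed.

Lemma sublinear_oppr_le q x : sublinear q -> - q (- x) <= q x.
Proof.
by move=> q_sub; have := q_sub.1 x (- x); rewrite subrr sublinear0 //; lra.
Qed.

Lemma inf_sublinear (S : V -> set R) :
  (forall x, S x !=set0) -> (forall x, has_lbound (S x)) ->
  (forall x y r r', S x r -> S y r' -> exists2 r'', S (x + y) r'' & r'' <= r + r') ->
  (forall a x r, 0 < a -> S x r -> S (a *: x) (a * r)) ->
  sublinear (fun x => inf (S x)).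
Proof.
move=> S0 Slb SD SZ; split=> [x y|a x a0].
  rewrite -lerBlDr; apply: lb_le_inf => // r Sr.
  rewrite lerBlDr -lerBlDl; apply: lb_le_inf => // r' Sr'; rewrite lerBlDl.
  by have [r'' Sr''] := SD _ _ _ _ Sr Sr'; apply: le_trans; exact: ge_inf.
have infZ b y : 0 < b -> b * inf (S y) <= inf (S (b *: y)).
  move=> b0; apply: lb_le_inf => // r Sr; rewrite -ler_pdivlMl //.
  apply: ge_inf => //; rewrite -[y](scalerK (lt0r_neq0 b0)).
  by apply: SZ; rewrite ?invr_gt0.
apply: le_anti; rewrite infZ // andbT -ler_pdivrMl //.
rewrite -[in leRHS](scalerK (lt0r_neq0 a0) x).
by apply: infZ; rewrite invr_gt0.
Qed.

Definition minimal_sublinear q := sublinear q /\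
  forall r, sublinear r -> (forall x, r x <= q x) -> forall x, q x <= r x.

Lemma minimal_sublinear_exists p : sublinear p ->
  exists2 q, minimal_sublinear q & forall x, q x <= p x.
Proof.
move=> p_sub; pose T := {q | sublinear q /\ forall x, q x <= p x}.
pose p' : T := exist _ p (conj p_sub (fun x => lexx (p x))).
pose le (q1 q2 : T) := `[< forall x, sval q2 x <= sval q1 x >].
have [||A Atot|[q [q_sub qp]] qmin] := @ZL_preorder T p' le.
- by move=> q; apply/asboolP.
- move=> q1 q2 q3 /asboolP h1 /asboolP h2; apply/asboolP => x.
  exact: le_trans (h2 x) (h1 x).
- pose S x := [set sval q x | q in p' |` A].
  have Slb x : has_lbound (S x).
    exists (- p (- x)) => _ [[q [q_sub qp]] _ <-] /=.
    by apply: le_trans (sublinear_oppr_le x q_sub); rewrite lerN2.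
  have pA_tot (q1 q2 : T) : (p' |` A) q1 -> (p' |` A) q2 -> le q1 q2 \/ le q2 q1.
    have p'_top (q : T) : le p' q by apply/asboolP => x; exact: (svalP q).2.
    by move=> [->|Aq1] [->|Aq2]; [left|left|right|exact: Atot].
  have S_sub : sublinear (fun x => inf (S x)).
    apply: inf_sublinear => // [x|x y _ _ [q1 Aq1 <-] [q2 Aq2 <-]|a x _ a0 [q Aq <-]].
    + by exists (p x), p' => //; left.
    + have [q Aq [qq1 qq2]] : exists2 q, (p' |` A) q & le q1 q /\ le q2 q.
        have refl (q : T) : le q q by apply/asboolP.
        by have [h|h] := pA_tot _ _ Aq1 Aq2; [exists q2|exists q1].
      exists (sval q (x + y)); first by exists q.
      apply: le_trans ((svalP q).1.1 x y) _.
      by rewrite lerD //; [move/asboolP: qq1|move/asboolP: qq2]; apply.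
    + by exists q => //; rewrite (svalP q).1.2.
  have Sp x : inf (S x) <= p x by apply: ge_inf => //; exists p' => //; left.
  exists (exist _ (fun x => inf (S x)) (conj S_sub Sp)) => q Aq.
  by apply/asboolP => x; apply: ge_inf => //; exists q => //; right.
exists q => //; split=> // r r_sub rq.
have rp x : r x <= p x by exact: le_trans (rq x) (qp x).
have /(_ (introT (asboolP _) rq))/asboolP := qmin (exist _ r (conj r_sub rp)).
exact.
Qed.

(* [x |-> inf_(0 <= t) (q (x + t *: y) - t * q y)] is again sublinear, and it maps
   [- y] to at most [- q y]. *)
Lemma minimal_sublinear_odd q y : minimal_sublinear q -> q (- y) = - q y.
Proof.
move=> [q_sub qmin]; apply: le_anti; rewrite [- q y <= _]lerNl sublinear_oppr_le // andbT.
pose S x := [set q (x + t *: y) - t * q y | t in [set t | 0 <= t]].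
have Sq x : S x (q x) by exists 0 => //=; rewrite scale0r addr0 mul0r subr0.
have Slb x : has_lbound (S x).
  exists (- q (- x)) => _ [t /= t0 <-].
  have tqy : q (t *: y) = t * q y.
    move: t0; rewrite le_eqVlt => /predU1P[<-|/q_sub.2 -> //].
    by rewrite scale0r mul0r sublinear0.
  have := q_sub.1 (x + t *: y) (- x); rewrite addrAC subrr add0r tqy; lra.
have S_sub : sublinear (fun x => inf (S x)).
  apply: inf_sublinear => // [x|x z _ _ [t /= t0 <-] [u /= u0 <-]|a x _ a0 [t /= t0 <-]].
  - by exists (q x).
  - exists (q (x + z + (t + u) *: y) - (t + u) * q y).
      by exists (t + u) => //=; rewrite addr_ge0.
    have := q_sub.1 (x + t *: y) (z + u *: y); rewrite addrACA -scalerDl; lra.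
  - exists (a * t) => /=; first by rewrite mulr_ge0 // ltW.
    by rewrite -scalerA -scalerDr q_sub.2 // mulrBr mulrA.
apply: le_trans (qmin _ S_sub _ (- y)) _ => [x|]; first exact: ge_inf.
apply: ge_inf => //; exists 1 => //=.
by rewrite scale1r addNr sublinear0 // mul1r add0r.
Qed.

Theorem hahn_banach p : sublinear p -> exists L : {scalar V}, forall x, L x <= p x.
Proof.
move=> /minimal_sublinear_exists[q qmin qp].
have [[qD qZ] _] := qmin; have qN x := minimal_sublinear_odd x qmin.
have q_linear : scalar q.
  have qD' x y : q (x + y) = q x + q y.
    apply: le_anti; rewrite qD /=; have := qD (x + y) (- y); rewrite addrK qN; lra.
  move=> a x y; rewrite qD'; congr (_ + _); case: (ltgtP a 0) => [a0|a0|->].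
  - by rewrite -[a in LHS]opprK scaleNr qN qZ ?oppr_gt0 // mulNr opprK.
  - exact: qZ.
  - by rewrite scale0r mul0r sublinear0.
by exists (scalar_pack q_linear).
Qed.

End HahnBanach.

Section RieszExtension.
Variables (R : realType) (U V : lmodType R) (i : {linear U -> V}) (K : set V).
Hypothesis cone0 : K 0.
Hypothesis coneD : forall x y, K x -> K y -> K (x + y).
Hypothesis coneZ : forall (a : R) x, 0 < a -> K x -> K (a *: x).
Hypothesis cofinal : forall x, exists u, K (i u - x).

Theorem riesz_extension (L0 : {scalar U}) :
  (forall u, K (i u) -> 0 <= L0 u) ->
  exists2 L : {scalar V}, forall u, L (i u) = L0 u & forall x, K x -> 0 <= L x.
Proof.
move=> L0_ge0; pose S x := [set L0 u | u in [set u | K (i u - x)]].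
have Slb x : has_lbound (S x).
  have [v Kv] := cofinal (- x); exists (- L0 v) => _ [u /= Ku <-].
  rewrite -subr_ge0 opprK -linearD L0_ge0 // linearD.
  have -> : i u + i v = (i u - x) + (i v - - x) by rewrite opprK addrACA addNr addr0.
  exact: coneD.
have S_sub : sublinear (fun x => inf (S x)).
  apply: inf_sublinear => // [x|x y _ _ [u /= Ku <-] [v /= Kv <-]|a x _ a0 [u /= Ku <-]].
  - by have [u Ku] := cofinal x; exists (L0 u), u.
  - exists (L0 (u + v)); last by rewrite linearD.
    by exists (u + v) => //=; rewrite linearD opprD addrACA; exact: coneD.
  - by exists (a *: u) => /=; rewrite linearZ // -scalerBr; exact: coneZ.
have [L Lp] := hahn_banach S_sub.
have L_le u x : K (i u - x) -> L x <= L0 u.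
  by move=> Ku; apply: le_trans (Lp x) _; apply: ge_inf => //; exists u.
have L_le_i u : L (i u) <= L0 u by rewrite L_le // subrr.
exists L => [u|x Kx]; first apply: le_anti.
  by rewrite L_le_i -[_ <= L _]lerN2 -!linearN L_le_i.
rewrite -oppr_le0 -linearN -[leRHS](linear0 L0).
by apply: L_le; rewrite linear0 sub0r opprK.
Qed.

End RieszExtension.
End ExtensionTheorems.

Module PolynomialGrowth.

Import all_boot all_order all_algebra boolp classical_sets functions reals lra.
Import Order.TTheory GRing.Theory Num.Theory.
Set Implicit Arguments. Unset Strict Implicit. Unset Printing Implicit Defensive.
Local Open Scope ring_scope.
Local Open Scope classical_set_scope.

Section GrowthFunctions.
Variable R : realType.
Implicit Types (x y a b t : R) (p : {poly R}).

Definition poly_growth : {pred R -> R^o} :=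
  mem [set f : R -> R^o | exists p, forall x, `|f x| <= p.[x]].

Lemma poly_growth_le_horner (f : R -> R^o) p :
  (forall x, `|f x| <= p.[x]) -> f \in poly_growth.
Proof. by move=> fp; rewrite inE; exists p. Qed.

Lemma poly_growth_submod : submod_closed poly_growth.
Proof.
split=> [|c f g]; first by apply: (@poly_growth_le_horner _ 0) => x; rewrite normr0 hornerC.
rewrite 2!inE => -[p fp] [q gq]; apply: (@poly_growth_le_horner _ (`|c| *: p + q)) => x.
by rewrite hornerD hornerZ (le_trans (ler_normD _ _)) // lerD // normrM ler_wpM2l.
Qed.

HB.instance Definition _ :=
  GRing.isSubmodClosed.Build R (R -> R^o) poly_growth poly_growth_submod.

Record growth_fun := GrowthFun {
  growth_val : R -> R^o;
  growth_valP : growth_val \in poly_growth }.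

HB.instance Definition _ := [isSub for growth_val].
HB.instance Definition _ := [Choice of growth_fun by <:].
HB.instance Definition _ := [SubChoice_isSubLmodule of growth_fun by <:].

Definition growth_eval (f : growth_fun) : R -> R := growth_val f.
Coercion growth_eval : growth_fun >-> Funclass.

Implicit Types f g : growth_fun.

Lemma growth_fun_le_horner f : exists p, forall x, `|f x| <= p.[x].
Proof. by have := growth_valP f; rewrite inE. Qed.

Lemma growth_funD f g x : (f + g) x = f x + g x.
Proof. by []. Qed.

Lemma growth_funB f g x : (f - g) x = f x - g x.
Proof. by []. Qed.

Lemma growth_funZ a f x : (a *: f) x = a * f x.
Proof. by []. Qed.

Lemma growth_fun_sum n (F : 'I_n -> growth_fun) x : (\sum_i F i) x = \sum_i F i x.
Proof. exact: (big_morph (fun f => f x)). Qed.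

Lemma horner_poly_growth p : (horner p : R -> R^o) \in poly_growth.
Proof.
apply: (@poly_growth_le_horner _ (1 + p ^+ 2)) => x; rewrite hornerD hornerC horner_exp.
by rewrite ler_norml; nra.
Qed.

Definition poly_fun p := GrowthFun (horner_poly_growth p).

Lemma poly_funE p x : poly_fun p x = p.[x].
Proof. by []. Qed.

Lemma poly_fun_linear : linear poly_fun.
Proof. by move=> a p q; apply/val_inj/funext => x; rewrite /= hornerD hornerZ. Qed.

HB.instance Definition _ :=
  GRing.isLinear.Build R {poly R} growth_fun _ poly_fun poly_fun_linear.

Lemma step_poly_growth t : ((fun x => (x <= t)%R%:R) : R -> R^o) \in poly_growth.
Proof.
by apply: (@poly_growth_le_horner _ 1) => x; rewrite hornerC normr_nat lern1 leq_b1.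
Qed.

Definition step t := GrowthFun (step_poly_growth t).

Lemma stepE t x : step t x = (x <= t)%R%:R.
Proof. by []. Qed.

Lemma step_incr a b x : a <= b -> step b x - step a x = (a < x <= b)%R%:R.
Proof.
move=> ab; rewrite !stepE; case: (leP x a) => xa /=; last by rewrite subr0.
by rewrite (le_trans xa ab) subrr.
Qed.

Lemma window_poly_growth f a b :
  ((fun x => f x * (step b x - step a x)) : R -> R^o) \in poly_growth.
Proof.
have [p fp] := growth_fun_le_horner f; apply: (@poly_growth_le_horner _ p) => x.
apply: le_trans (fp x); rewrite normrM ler_piMr // !stepE.
by case: (x <= b); case: (x <= a); rewrite ?subr0 ?sub0r ?subrr ?normrN ?normr1 ?normr0.
Qed.

Definition window f a b := GrowthFun (window_poly_growth f a b).

Lemma windowE f a b x : window f a b x = f x * (step b x - step a x).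
Proof. by []. Qed.

End GrowthFunctions.

Section PositiveFunctionals.
Variables (R : realType) (L : {scalar growth_fun R}).

Definition positive_functional (F : growth_fun R -> R) :=
  forall f : growth_fun R, (forall x, 0 <= f x) -> 0 <= F f.

Hypothesis L_ge0 : positive_functional L.
Implicit Types (f g : growth_fun R) (a b t : R).

Definition cdf t := L (step t).

Lemma positive_functional_le f g : (forall x, f x <= g x) -> L f <= L g.
Proof.
by move=> fg; rewrite -subr_ge0 -linearB L_ge0 // => x; rewrite growth_funB subr_ge0.
Qed.

Lemma positive_functional_norm_le f g : (forall x, `|f x| <= g x) -> `|L f| <= L g.
Proof.
move=> fg; rewrite ler_norml -linearN; apply/andP.
by split; apply: positive_functional_le => x; have := fg x; rewrite ler_norml => /andP[].
Qed.

Lemma cdf_nondecreasing : {homo cdf : s t / s <= t}.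
Proof.
move=> s t st; apply: positive_functional_le => x.
by rewrite !stepE ler_nat; case: (leP x s) => // /le_trans ->.
Qed.

Lemma window_sum_le (n : nat) (p t : nat -> R) f (e : R) :
  (forall i, (i < n)%N -> p i <= p i.+1) ->
  (forall i x, (i < n)%N -> p i < x <= p i.+1 -> `|f x - f (t i)| <= e) ->
  `|L (window f (p 0) (p n)) - \sum_(i < n) f (t i) * (cdf (p i.+1) - cdf (p i))|
    <= e * (cdf (p n) - cdf (p 0)).
Proof.
move=> pS fe; pose S := \sum_(i < n) f (t i) *: (step (p i.+1) - step (p i)).
have -> : \sum_(i < n) f (t i) * (cdf (p i.+1) - cdf (p i)) = L S.
  by rewrite linear_sum; apply: eq_bigr => i _; rewrite linearZ linearB.
rewrite -linearB -[cdf (p n) - _]linearB -linearZ.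
apply: positive_functional_norm_le => x.
have telescope : step (p n) x - step (p 0) x =
    \sum_(i < n) (step (p i.+1) x - step (p i) x).
  by rewrite -(telescope_sumr (fun i => step (p i) x)) // big_mkord.
rewrite growth_funB growth_funZ growth_funB growth_fun_sum.
rewrite windowE telescope !mulr_sumr -sumrB.
apply: le_trans (ler_norm_sum _ _ _) (ler_sum _ _) => i _.
rewrite growth_funZ growth_funB -mulrBl step_incr ?pS // normrM normr_nat.
by have [/fe fe_i|_] := boolP (_ < _ <= _); rewrite ?mulr0 // !mulr1 fe_i.
Qed.

Lemma window_tail f : exists C, forall M a b : R, 0 < M -> a <= - M -> M <= b ->
  `|L (window f a b) - L f| <= C / M.
Proof.
have [p fp] := growth_fun_le_horner f.
exists (L (poly_fun ((1 + 'X^2) * p))) => M a b M0 aM Mb.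
rewrite -linearB mulrC -linearZ; apply: positive_functional_norm_le => x.
have p_ge0 : 0 <= p.[x] by apply: le_trans (fp x).
rewrite growth_funB growth_funZ windowE step_incr; last by lra.
rewrite poly_funE hornerM hornerD hornerC hornerXn mulrA.
have [x_in|x_out] := boolP (a < x <= b).
  rewrite mulr1 subrr normr0 mulr_ge0 // mulr_ge0 ?addr_ge0 ?sqr_ge0 ?invr_ge0 //.
  exact: ltW.
rewrite mulr0 sub0r normrN; apply: le_trans (fp x) _; rewrite ler_peMl //.
rewrite ler_pdivlMl // mulr1; move: x_out; rewrite negb_and -leNgt -ltNge.
by case/orP=> ?; nra.
Qed.

End PositiveFunctionals.

End PolynomialGrowth.

Module MomentFunctionals.

Import all_boot all_order all_algebra boolp classical_sets reals ring.
Import Order.TTheory GRing.Theory Num.Theory.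
Import RealPolynomials StepMajorants ExtensionTheorems PolynomialGrowth.
Set Implicit Arguments. Unset Strict Implicit. Unset Printing Implicit Defensive.
Local Open Scope ring_scope.

Section RieszFunctional.
Variables (R : comNzRingType) (s : nat -> R).
Implicit Types p : {poly R}.

Definition riesz p : R := \sum_(i < size p) p`_i * s i.

Lemma riesz_widen n p : (size p <= n)%N -> riesz p = \sum_(i < n) p`_i * s i.
Proof.
move=> pn; rewrite /riesz (big_ord_widen n (fun i => p`_i * s i) pn) big_mkcond /=.
by apply: eq_bigr => i _; case: ltnP => // ?; rewrite nth_default ?mul0r.
Qed.

Lemma riesz_scalar : scalar riesz.
Proof.
move=> a p q; pose n := maxn (size p) (size q).
have sn : (size (a *: p + q)%R <= n)%N.
  rewrite (leq_trans (size_polyD _ _)) // geq_max leq_maxr andbT.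
  by rewrite (leq_trans (size_scale_leq _ _)) ?leq_maxl.
rewrite (riesz_widen sn) (riesz_widen (leq_maxl _ _ : (_ <= n)%N)).
rewrite (riesz_widen (leq_maxr _ _ : (_ <= n)%N)) mulr_sumr -big_split /=.
by apply: eq_bigr => i _; rewrite coefD coefZ mulrDl mulrA.
Qed.

HB.instance Definition _ := GRing.isLinear.Build R {poly R} R _ riesz riesz_scalar.

Lemma rieszXn k : riesz 'X^k = s k.
Proof.
rewrite /riesz size_polyXn big_ord_recr big1 /= ?add0r ?coefXn ?eqxx ?mul1r // => i _.
by rewrite coefXn ltn_eqF ?mul0r.
Qed.

Lemma riesz_sqr n p : (size p <= n)%N ->
  riesz (p ^+ 2) = \sum_(i < n) \sum_(j < n) p`_i * p`_j * s (i + j)%N.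
Proof.
move=> pn; have {1}-> : p = \sum_(i < n) p`_i *: 'X^i.
  rewrite -{1}[p]coefK poly_def (big_ord_widen n (fun i => p`_i *: 'X^i) pn) big_mkcond.
  by apply: eq_bigr => i _; case: ltnP => // ?; rewrite nth_default ?scale0r.
rewrite expr2 mulr_suml linear_sum; apply: eq_bigr => i _.
rewrite mulr_sumr linear_sum; apply: eq_bigr => j _.
by rewrite -scalerAl -scalerAr -exprD scalerA linearZ /= rieszXn.
Qed.

End RieszFunctional.

Lemma riesz_subseq (R : comNzRingType) (s : nat -> R) d l p :
  riesz (fun k => s (k * d + l)%N) p = riesz s ('X^l * (p \Po 'X^d)).
Proof.
rewrite comp_polyE mulr_sumr linear_sum; apply: eq_bigr => i _.
by rewrite -scalerAr -exprM -exprD linearZ /= rieszXn addnC mulnC.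
Qed.

Lemma riesz_subseq_sqr (R : comNzRingType) (s : nat -> R) d l p :
  riesz (fun k => s (k * d + 2 * l)%N) (p ^+ 2) =
  riesz s (('X^l * (p \Po 'X^d)) ^+ 2).
Proof. by rewrite riesz_subseq rmorphXn /= exprMn -exprM mulnC. Qed.

Section PositiveOnSquares.
Variable R : realType.
Implicit Types (F : {scalar {poly R}}) (p : {poly R}) (t c : R).

Definition positive_on_squares (G : {poly R} -> R) := forall p, 0 <= G (p ^+ 2).

Definition evaluation_bounded (G : {poly R} -> R) t :=
  exists2 c, 0 < c & forall p, c * p.[t] ^+ 2 <= G (p ^+ 2).

Definition extends (L : growth_fun R -> R) (G : {poly R} -> R) :=
  forall p, L (poly_fun p) = G p.

Lemma positive_on_squares_ge0 F p :
  positive_on_squares F -> (forall x, 0 <= p.[x]) -> 0 <= F p.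
Proof.
by move=> F_sq /nonneg_sum_two_squares[f [g ->]]; rewrite linearD addr_ge0.
Qed.

Lemma positive_on_squares_le F p q :
  positive_on_squares F -> (forall x, p.[x] <= q.[x]) -> F p <= F q.
Proof.
move=> F_sq pq; rewrite -subr_ge0 -linearB positive_on_squares_ge0 // => x.
by rewrite hornerD hornerN subr_ge0.
Qed.

Lemma positive_extension F : positive_on_squares F ->
  exists2 L : {scalar growth_fun R}, positive_functional L & extends L F.
Proof.
move=> F_sq; pose K := [set f : growth_fun R | forall x, 0 <= f x]%classic.
have K0 : K 0 by move=> x; rewrite lexx.
have KD f g : K f -> K g -> K (f + g).
  by move=> Kf Kg x; rewrite growth_funD addr_ge0.
have KZ (a : R) f : 0 < a -> K f -> K (a *: f).
  by move=> a0 Kf x; rewrite growth_funZ mulr_ge0 // ltW.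
have K_cofinal f : exists p, K (poly_fun p - f).
  have [p fp] := growth_fun_le_horner f; exists p => x.
  by rewrite growth_funB subr_ge0 poly_funE (le_trans (ler_norm _)).
have [p p_ge0|L LF L_ge0] := riesz_extension K0 KD KZ K_cofinal (L0 := F).
  exact: positive_on_squares_ge0.
by exists L.
Qed.

(* Removing the atom [c] at [t] keeps the functional positive on squares; extend what is
   left, and put the atom back. *)
Lemma positive_extension_atom F t : evaluation_bounded F t ->
  exists L : {scalar growth_fun R}, [/\ positive_functional L, extends L F &
    exists2 c, 0 < c & forall a b, a < t <= b -> c <= cdf L b - cdf L a].
Proof.
move=> [c c0 cF]; have Fc_scalar : scalar (fun p => F p - c * p.[t]).
  by move=> a p q /=; rewrite linearD linearZ hornerD hornerZ /=; ring.
have [|L L_ge0 Lext] := @positive_extension (scalar_pack Fc_scalar).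
  by move=> p; rewrite scalar_packE subr_ge0 horner_exp.
pose Lc (f : growth_fun R) := L f + c * f t.
have Lc_scalar : scalar Lc.
  by move=> a f g; rewrite /Lc linearD linearZ growth_funD growth_funZ /=; ring.
exists (scalar_pack Lc_scalar); split=> [f f_ge0|p|].
- by rewrite scalar_packE addr_ge0 ?L_ge0 // mulr_ge0 // ltW.
- by rewrite scalar_packE /Lc Lext scalar_packE poly_funE subrK.
exists c => // a b /[dup] atb /andP[/ltW/le_trans at_ /at_ ab].
rewrite /cdf !scalar_packE /Lc opprD addrACA -mulrBr step_incr // atb mulr1.
by rewrite lerDr subr_ge0 cdf_nondecreasing.
Qed.

Lemma evaluation_unbounded_step F t (e : R) : positive_on_squares F ->
  ~ evaluation_bounded F t -> 0 < e -> exists U V : {poly R},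
    [/\ forall x, 0 <= U.[x], forall x, x <= t -> 1 <= U.[x],
        forall x, V.[x] <= 1, forall x, t <= x -> V.[x] <= 0 &
        F U - F V < e].
Proof.
move=> F_sq unbounded e0.
have [p pe] : exists p, F (p ^+ 2) < e * p.[t] ^+ 2.
  apply: contrapT => small; apply: unbounded; exists e => // p.
  by rewrite leNgt; apply/negP => pe; apply: small; exists p.
have pt : p.[t] != 0.
  by apply: contraTneq pe => ->; rewrite expr0n mulr0 -leNgt.
have p2 : 0 < p.[t] ^+ 2 by rewrite lt_def sqr_ge0 expf_eq0 pt.
have [U [V [U0 U1 V1 V0 UV]]] := chebyshev_markov_stieltjes pt.
exists U, V; split=> //; rewrite -linearB -(ltr_pM2l p2) -linearZ [ltRHS]mulrC.
apply: le_lt_trans pe; apply: positive_on_squares_le => // x.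
by rewrite hornerZ horner_exp.
Qed.

End PositiveOnSquares.

Lemma evaluation_bounded_subseq (R : realType) (s : nat -> R) d l (t : R) : t != 0 ->
  evaluation_bounded (riesz s) t ->
  evaluation_bounded (riesz (fun k => s (k * d + 2 * l)%N)) (t ^+ d).
Proof.
move=> t0 [c c0 cs]; exists (c * (t ^+ l) ^+ 2) => [|p].
  by rewrite mulr_gt0 // lt_def sqr_ge0 expf_eq0 /= expf_eq0 (negbTE t0) andbF.
rewrite riesz_subseq_sqr; apply: le_trans (cs _).
by rewrite hornerM hornerXn horner_comp hornerXn -mulrA -exprMn.
Qed.

End MomentFunctionals.

Module CountableSets.

Import all_boot all_order all_algebra polyrcf.
Import boolp classical_sets cardinality reals.
Import topology normedtype sequences lra.
Import Order.TTheory GRing.Theory Num.Theory numFieldNormedType.Exports.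
Set Implicit Arguments. Unset Strict Implicit. Unset Printing Implicit Defensive.
Local Open Scope ring_scope.
Local Open Scope classical_set_scope.

Section Countability.
Variable R : realType.

Definition continuity_point (F : R -> R) (x : R) := {for x, continuous F}.

Lemma continuity_pointP (F : R -> R) (x : R) : continuity_point F x <->
  forall e, 0 < e -> exists2 d, 0 < d & forall y, `|x - y| < d -> `|F x - F y| < e.
Proof.
by split=> [/cvgrPdist_lt F_cont e /F_cont[d]|F_cont]; [exists d|exact/cvgrPdist_lt].
Qed.

Lemma nondecreasing_discontinuity_gap (F : R -> R) (x : R) :
  {homo F : y z / y <= z} -> ~ continuity_point F x ->
  exists q : rat, (forall y, y < x -> F y < ratr q) /\ (forall y, x < y -> ratr q < F y).
Proof.
move=> F_nd Fx_disc.
have [e e0 jump] : exists2 e, 0 < e &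
    (forall y, y < x -> F y <= F x - e) \/ (forall y, x < y -> F x + e <= F y).
  apply: contrapT => no_jump; apply: Fx_disc; apply/cvgrPdist_lt => e e0.
  have [y yx Fy] : exists2 y, y < x & F x - e < F y.
    apply: contrapT => left_jump; apply: no_jump; exists e => //; left => y yx.
    by rewrite leNgt; apply/negP => Fy; apply: left_jump; exists y.
  have [z xz Fz] : exists2 z, x < z & F z < F x + e.
    apply: contrapT => right_jump; apply: no_jump; exists e => //; right => z xz.
    by rewrite leNgt; apply/negP => Fz; apply: right_jump; exists z.
  near=> u; rewrite distrC ltr_distl; apply/andP; split.
    by apply: lt_le_trans Fy _; apply: F_nd; apply/ltW; near: u; exact: lt_nbhsr.
  by apply: le_lt_trans Fz; apply: F_nd; apply/ltW; near: u; exact: lt_nbhsl.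
case: jump => [jump|jump].
  have /rat_in_itvoo[q /itvP q_in] : F x - e < F x by lra.
  exists q; split=> y xy; first by apply: le_lt_trans (jump y xy) _; rewrite q_in.
  by apply: lt_le_trans (F_nd _ _ (ltW xy)); rewrite q_in.
have /rat_in_itvoo[q /itvP q_in] : F x < F x + e by lra.
exists q; split=> y xy; last by apply: lt_le_trans (jump y xy); rewrite q_in.
by apply: le_lt_trans (F_nd _ _ (ltW xy)) _; rewrite q_in.
Unshelve. all: by end_near. Qed.

Lemma countable_discontinuities (F : R -> R) :
  {homo F : y z / y <= z} -> countable (~` continuity_point F).
Proof.
move=> F_nd; set D := ~` _.
have /choice[q gap] x : exists r : rat, D x ->
    (forall y, y < x -> F y < ratr r) /\ (forall y, x < y -> ratr r < F y).
  have [Dx|nDx] := pselect (D x); last by exists 0.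
  by have [r] := nondecreasing_discontinuity_gap F_nd Dx; exists r.
apply/countable_injP; exists (pickle \o q) => x y /set_mem Dx /set_mem Dy.
move=> /(pcan_inj pickleK) qxy.
wlog xy : x y Dx Dy qxy / x < y.
  by move=> wlog; have [/wlog|/wlog|//] := ltgtP x y; [apply|move=> h; apply/esym/h].
have [x_m m_y] := midf_lt xy.
have := (gap x Dx).2 _ x_m; have := (gap y Dy).1 _ m_y; rewrite qxy.
by move=> /lt_trans/[apply]; rewrite ltxx.
Qed.

Lemma countable_setU T (A B : set T) : countable A -> countable B -> countable (A `|` B).
Proof.
by move=> A_cnt B_cnt; rewrite -bigcup2E; apply: bigcup_countable => // -[|[|]].
Qed.

Lemma countable_dense_setC (A : set R) : countable A -> dense (~` A).
Proof.
move=> /countable_injP[f f_inj]; pose F n := ~` [set x | A x /\ f x = n].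
have F_open_dense n : open (F n) /\ dense (F n).
  have [[x [Ax fx]]|F_empty] := pselect ([set x | A x /\ f x = n] !=set0); last first.
    rewrite (_ : F n = setT); last first.
      by apply/seteqP; split=> // x _ Axn; apply: F_empty; exists x.
    by split; [exact: openT|move=> O [x Ox] _; exists x].
  have -> : F n = ~` [set x].
    congr (~` _); apply/seteqP; split=> y /=; last by move=> ->.
    by move=> [Ay fy]; apply: f_inj; rewrite ?inE // fx fy.
  split; last exact: dense_set1C.
  by rewrite openC; exact/accessible_closed_set1/hausdorff_accessible/Rhausdorff.
move=> O O0 O_open; have [x [Ox Fx]] := Baire F_open_dense O0 O_open.
by exists x; split=> // Ax; apply: (Fx (f x)).
Qed.

Lemma countable_preimage_exp d (A : set R) : (0 < d)%N ->
  countable A -> countable [set t | A (t ^+ d)].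
Proof.
move=> d0 A_cnt; have -> : [set t | A (t ^+ d)] = \bigcup_(w in A) [set t | t ^+ d = w].
  by apply/seteqP; split=> [t At|t [w Aw /= ->] //]; exists (t ^+ d).
apply: bigcup_countable => // w _.
apply: (@sub_countable _ _ _ [set` rootsR ('X^d - w%:P)]).
  apply: subset_card_le => t /= tw; rewrite -roots_on_rootsR.
    by rewrite in_itv /= rootE !hornerE tw subrr.
  by rewrite -size_poly_gt0 size_XnsubC.
exact/finite_set_countable/finite_seq.
Qed.

Lemma dense_setC_near (A B : set R) (x : R) :
  dense (~` A) -> nbhs x B -> exists2 t, B t & ~ A t.
Proof.
move=> A_dense; rewrite nbhsE => -[O [O_open Ox] OB].
by have [t [/OB Bt At]] := A_dense O (ex_intro _ x Ox) O_open; exists t.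
Qed.

End Countability.
End CountableSets.

Module StieltjesSums.

Import all_boot all_order all_algebra polyrcf lra.
Import boolp classical_sets cardinality reals topology normedtype.
Import Order.TTheory GRing.Theory Num.Theory numFieldNormedType.Exports.
Import PolynomialGrowth MomentFunctionals CountableSets.
Set Implicit Arguments. Unset Strict Implicit. Unset Printing Implicit Defensive.
Local Open Scope ring_scope.
Local Open Scope classical_set_scope.

Section MarkedPartitions.
Variable R : realType.

Record marked_partition := MarkedPartition {
  part_size : nat; node : nat -> R; mark : nat -> R }.

Implicit Types (P : marked_partition) (f g sigma : R -> R) (a b d e t I : R).

Definition partitions_itv a b P :=
  [/\ node P 0 = a, node P (part_size P) = b,
      forall i, (i < part_size P)%N -> node P i < node P i.+1 &
      forall i, (i < part_size P)%N -> node P i <= mark P i <= node P i.+1].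

Definition mesh_below d P :=
  forall i, (i < part_size P)%N -> node P i.+1 - node P i < d.

Definition stieltjes_sum f sigma P : R := \sum_(i < part_size P)
  f (mark P i) * (sigma (node P i.+1) - sigma (node P i)).

Definition fine_partitions a b : set_system marked_partition :=
  filter_from [set d | 0 < d] (fun d => [set P | partitions_itv a b P /\ mesh_below d P]).

Definition exhausting_partitions : set_system marked_partition :=
  [set A | exists M, forall a b, a <= - M -> M <= b -> fine_partitions a b A].

#[global] Instance fine_partitions_filter a b : Filter (fine_partitions a b).
Proof.
apply: filter_from_filter; first by exists 1; rewrite /= ltr01.
move=> d e /= d0 e0; exists (Num.min d e); first by rewrite /= lt_min d0.
by move=> P /= [Pab fineP]; split; split=> // i /fineP; rewrite lt_min => /andP[].
Qed.

#[global] Instance exhausting_partitions_filter : Filter exhausting_partitions.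
Proof.
split=> [|A B [M AM] [N BN]|A B AB [M AM]].
- by exists 0 => a b _ _; exact: filterT.
- exists (Num.max M N) => a b; rewrite lerNr !ge_max => /andP[aM aN] /andP[Mb Nb].
  by apply: filterI; [apply: AM|apply: BN]; rewrite // lerNr.
- by exists M => a b aM Mb; apply: filterS AB (AM a b aM Mb).
Qed.

Definition stieltjes_lim f sigma (F : set_system marked_partition) I :=
  stieltjes_sum f sigma P @[P --> F] --> I.

Lemma stieltjes_lim_fineP f sigma a b I :
  stieltjes_lim f sigma (fine_partitions a b) I <->
  forall e, 0 < e -> exists2 d, 0 < d & forall P,
    partitions_itv a b P -> mesh_below d P -> `|stieltjes_sum f sigma P - I| < e.
Proof.
split=> [/cvgrPdist_lt sumI e e0|sumI]; last apply/cvgrPdist_lt => e e0.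
  by have [d d0 dI] := sumI e e0; exists d => // P Pab Pd; rewrite distrC; exact: dI.
by have [d d0 dI] := sumI e e0; exists d => // P [Pab Pd]; rewrite distrC; exact: dI.
Qed.

Lemma stieltjes_lim_exhausting f sigma I :
  (forall e, 0 < e -> exists M, forall a b, a <= - M -> M <= b ->
    exists J, stieltjes_lim f sigma (fine_partitions a b) J /\ `|J - I| < e) ->
  stieltjes_lim f sigma exhausting_partitions I.
Proof.
move=> f_lim; apply/cvgrPdist_lt => e e0.
have e20 : 0 < e / 2 by rewrite divr_gt0.
have [M f_M] := f_lim _ e20; exists M => a b aM Mb.
have [J [/cvgrPdist_lt/(_ _ e20) f_J J_I]] := f_M a b aM Mb.
apply: filterS f_J => P; move: J_I; rewrite !ltr_norml; lra.
Qed.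

Lemma partition_node_le a b P i j : partitions_itv a b P ->
  (i <= j <= part_size P)%N -> node P i <= node P j.
Proof.
move=> [_ _ P_incr _] /andP[]; elim: j => [|j IHj]; first by rewrite leqn0 => /eqP ->.
rewrite leq_eqVlt => /predU1P[-> //|ij] jP.
by rewrite (le_trans (IHj ij (ltnW jP))) // ltW // P_incr.
Qed.

Lemma fine_partition_with_marks (m : R -> R -> R) a b A : a < b ->
  (forall x y, x < y -> x <= m x y <= y) -> fine_partitions a b A ->
  exists P, [/\ A P, partitions_itv a b P &
    forall i, mark P i = m (node P i) (node P i.+1)].
Proof.
move=> ab m_in [d /= d0 dA].
have [n n_gt] : exists n : nat, (b - a) / d < n%:R.
  exists (Num.bound ((b - a) / d)); apply: archi_boundP.
  by rewrite divr_ge0 ?subr_ge0 // ltW.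
have n0 : 0 < n%:R :> R by apply: lt_trans n_gt; rewrite divr_gt0 // subr_gt0.
pose h := (b - a) / n%:R.
have h0 : 0 < h by rewrite divr_gt0 // subr_gt0.
pose p i := a + h *+ i.
have pS i : p i.+1 = p i + h by rewrite /p mulrSr addrA.
pose P := MarkedPartition n p (fun i => m (p i) (p i.+1)).
have Pab : partitions_itv a b P.
  split=> [||i _|i _] /=; rewrite ?pS ?ltrDl ?m_in ?ltrDl //; first by rewrite /p addr0.
  by rewrite /p -mulr_natr /h divfK ?gt_eqF // addrC subrK.
exists P; split=> //; apply: dA; split=> // i _ /=.
by rewrite pS addrAC subrr add0r /h ltr_pdivrMr // mulrC -ltr_pdivrMr.
Qed.

Definition clamp t x y := Num.max x (Num.min t y).

Lemma clamp_itv t x y : x < y -> x <= clamp t x y <= y.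
Proof. by move=> xy; rewrite le_max lexx /= ge_max ge_min lexx orbT andbT ltW. Qed.

Lemma partition_telescope (G : R -> R) a b P : partitions_itv a b P ->
  G b - G a = \sum_(i < part_size P) (G (node P i.+1) - G (node P i)).
Proof.
move=> [<- <- _ _].
by rewrite -(big_mkord xpredT (fun i => G (node P i.+1) - G (node P i))) telescope_sumr.
Qed.

Section StepBounds.
Variables (f sigma : R -> R) (a b t : R) (P : marked_partition).
Hypothesis sigma_nd : {homo sigma : x y / x <= y}.
Hypothesis atb : a < t < b.
Hypothesis Pab : partitions_itv a b P.
Hypothesis P_marks : forall i, mark P i = clamp t (node P i) (node P i.+1).

Lemma stieltjes_sum_ge_step :
  (forall x, 0 <= f x) -> (forall x, x <= t -> 1 <= f x) ->
  sigma t - sigma a <= stieltjes_sum f sigma P.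
Proof.
move=> f_ge0 f_ge1; have /andP[/ltW at_ /ltW tb] := atb.
have := partition_telescope (fun x => sigma (Num.min x t)) Pab.
rewrite (min_l at_) (min_r tb) => ->; apply: ler_sum => i _; rewrite P_marks /=.
have [_ _ /(_ i (ltn_ord i)) /ltW xy _] := Pab.
set x := node P i in xy *; set y := node P i.+1 in xy *.
have sxy : 0 <= sigma y - sigma x by rewrite subr_ge0 sigma_nd.
have [xt|/ltW tx] := leP x t; last first.
  by rewrite !min_r ?(le_trans tx) // subrr mulr_ge0.
apply: (@le_trans _ _ (sigma y - sigma x)).
  by rewrite lerB // sigma_nd // ge_min lexx.
by rewrite ler_peMl // f_ge1 // /clamp ge_max xt ge_min lexx.
Qed.

Lemma stieltjes_sum_le_step :
  (forall x, f x <= 1) -> (forall x, t <= x -> f x <= 0) ->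
  stieltjes_sum f sigma P <= sigma t - sigma a.
Proof.
move=> f_le1 f_le0; have /andP[/ltW at_ /ltW tb] := atb.
have := partition_telescope (fun x => sigma (Num.min x t)) Pab.
rewrite (min_l at_) (min_r tb) => ->; apply: ler_sum => i _; rewrite P_marks /=.
have [_ _ /(_ i (ltn_ord i)) /ltW xy _] := Pab.
set x := node P i in xy *; set y := node P i.+1 in xy *.
have sxy : 0 <= sigma y - sigma x by rewrite subr_ge0 sigma_nd.
have [yt|/ltW ty] := leP y t.
  by rewrite !min_l ?(le_trans xy) // ler_piMl.
apply: (@le_trans _ _ 0).
  by rewrite mulr_le0_ge0 // f_le0 // le_max le_min lexx ty orbT.
by rewrite subr_ge0 sigma_nd // ge_min lexx orbT.
Qed.

End StepBounds.
End MarkedPartitions.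

Arguments exhausting_partitions : clear implicits.

Section MomentSolutions.
Variables (R : realType) (s : nat -> R).
Implicit Types (sigma tau : R -> R) (a e t : R).

Definition represents sigma := {homo sigma : x y / x <= y} /\
  forall k, stieltjes_lim (fun x => x ^+ k) sigma (exhausting_partitions R) (s k).

Lemma represents_horner sigma (p : {poly R}) : represents sigma ->
  stieltjes_lim (horner p) sigma (exhausting_partitions R) (riesz s p).
Proof.
move=> [_ moments]; rewrite /stieltjes_lim.
have -> : stieltjes_sum (horner p) sigma =
    (fun P => \sum_(k < size p) p`_k * stieltjes_sum (fun x => x ^+ k) sigma P).
  apply/funext => P; under [RHS]eq_bigr do rewrite mulr_sumr.
  rewrite exchange_big; apply: eq_bigr => i _.
  by rewrite horner_coef mulr_suml; apply: eq_bigr => k _; rewrite mulrA.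
apply: cvg_big => [|k _]; first exact: add_continuous.
by apply: cvgM; [exact: cvg_cst|exact: moments].
Qed.

Lemma represents_marked sigma p e (m : R -> R -> R) t : represents sigma -> 0 < e ->
   (forall x y, x < y -> x <= m x y <= y) ->
  \forall a \near -oo, exists b P, [/\ a < t < b, partitions_itv a b P,
    forall i, mark P i = m (node P i) (node P i.+1) &
    `|stieltjes_sum (horner p) sigma P - riesz s p| < e].
Proof.
move=> sigma_s e0 m_in.
have /cvgrPdist_lt/(_ e e0)[M sumM] := represents_horner (p := p) sigma_s.
near=> a; pose b := - a.
have ab : a < t < b.
  apply/andP; split; first by near: a; apply: nbhs_ninfty_lt; exact: num_real.
  by rewrite ltrNr; near: a; apply: nbhs_ninfty_lt; exact: num_real.
have /andP[at_ tb] := ab.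
have [||P [PI Pab Pm]] := fine_partition_with_marks (lt_trans at_ tb) m_in (sumM a b _ _).
- by near: a; apply: nbhs_ninfty_le; exact: num_real.
- by rewrite lerNr; near: a; apply: nbhs_ninfty_le; exact: num_real.
by exists b, P; split; rewrite // distrC.
Unshelve. all: by end_near. Qed.

Lemma represents_lt_majorant sigma (U : {poly R}) e t : represents sigma -> 0 < e ->
  (forall x, 0 <= U.[x]) -> (forall x, x <= t -> 1 <= U.[x]) ->
  \forall a \near -oo, sigma t - sigma a < riesz s U + e.
Proof.
move=> sigma_s e0 U_ge0 U_ge1.
have := represents_marked U t sigma_s e0 (@clamp_itv _ t).
apply: filterS => a [b [P [atb Pab Pm]]].
rewrite ltr_distl => /andP[_]; apply: le_lt_trans.
exact: stieltjes_sum_ge_step sigma_s.1 atb Pab Pm U_ge0 U_ge1.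
Qed.

Lemma represents_gt_minorant sigma (V : {poly R}) e t : represents sigma -> 0 < e ->
  (forall x, V.[x] <= 1) -> (forall x, t <= x -> V.[x] <= 0) ->
  \forall a \near -oo, riesz s V - e < sigma t - sigma a.
Proof.
move=> sigma_s e0 V_le1 V_le0.
have := represents_marked V t sigma_s e0 (@clamp_itv _ t).
apply: filterS => a [b [P [atb Pab Pm]]].
rewrite ltr_distl => /andP[+ _]; move/lt_le_trans; apply.
exact: stieltjes_sum_le_step sigma_s.1 atb Pab Pm V_le1 V_le0.
Qed.

Hypothesis s_sq : positive_on_squares (riesz s).

Lemma represents_sub_lt sigma tau e t :
  represents sigma -> represents tau -> ~ evaluation_bounded (riesz s) t -> 0 < e ->
  \forall a \near -oo, (sigma t - sigma a) - (tau t - tau a) < e.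
Proof.
move=> sigma_s tau_s unbounded e0.
have e20 : 0 < e / 2 by rewrite divr_gt0.
have e40 : 0 < e / 4 by rewrite divr_gt0.
have [U [V [U0 U1 V1 V0 UV]]] := evaluation_unbounded_step s_sq unbounded e20.
have sigmaU := represents_lt_majorant sigma_s e40 U0 U1.
have tauV := represents_gt_minorant tau_s e40 V1 V0.
by apply: filterS2 sigmaU tauV => a /=; lra.
Qed.

Lemma represents_sub_cvg sigma tau t :
  represents sigma -> represents tau -> ~ evaluation_bounded (riesz s) t ->
  sigma a - tau a @[a --> -oo] --> sigma t - tau t.
Proof.
move=> sigma_s tau_s unbounded; apply/cvgrPdist_lt => e e0.
have st := represents_sub_lt sigma_s tau_s unbounded e0.
have ts := represents_sub_lt tau_s sigma_s unbounded e0.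
by apply: filterS2 st ts => a /= ? ?; rewrite ltr_norml; lra.
Qed.

Definition equal_up_to_constant sigma tau := exists k, forall x,
  continuity_point (sigma \- tau) x -> sigma x - tau x = k.

Lemma represents_unique sigma tau : represents sigma -> represents tau ->
  countable (evaluation_bounded (riesz s)) -> equal_up_to_constant sigma tau.
Proof.
move=> sigma_s tau_s /countable_dense_setC unbounded_dense.
have [t0 _ t0_unbounded] := dense_setC_near unbounded_dense (@filterT _ (nbhs (0 : R)) _).
have t0_lim := represents_sub_cvg sigma_s tau_s t0_unbounded.
exists (sigma t0 - tau t0) => x x_cont; apply/eqP; rewrite -subr_eq0 -normr_le0.
apply/ler_addgt0Pr => e e0; rewrite add0r.
have /cvgrPdist_lt/(_ e e0) := x_cont.
move=> /(dense_setC_near unbounded_dense)[t /ltW + t_unbounded].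
have t_lim := represents_sub_cvg sigma_s tau_s t_unbounded.
by have -> : sigma t0 - tau t0 = sigma t - tau t by exact: cvg_unique t0_lim t_lim.
Qed.

End MomentSolutions.

Section Jumps.
Variable R : realType.
Implicit Types (sigma tau : R -> R) (c t : R).

Definition jumps_at c tau t := forall a b, a < t <= b -> c <= tau b - tau a.

Lemma equal_up_to_constant_jump sigma tau c t :
  {homo sigma : x y / x <= y} -> {homo tau : x y / x <= y} ->
  equal_up_to_constant sigma tau -> jumps_at c tau t ->
  forall a b, a < t -> t < b -> c <= sigma b - sigma a.
Proof.
move=> sigma_nd tau_nd [k sub_const] tau_jump a b at_ tb.
have := countable_setU (countable_discontinuities sigma_nd)
  (countable_discontinuities tau_nd).
move=> /countable_dense_setC cont_dense.
have common_continuity_point x y : x < y -> exists2 z, x < z < y & sigma z - tau z = k.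
  move=> xy; have [||z [/=]] := cont_dense `]x, y[%classic.
  - by have [xm my] := midf_lt xy; exists ((x + y) / 2); rewrite /= in_itv /= xm my.
  - exact: interval_open.
  rewrite in_itv /= => z_in /not_orP[/contrapT sigma_z /contrapT tau_z].
  by exists z => //; apply: sub_const; exact: continuousB.
have [a' /andP[aa' a't] a'E] := common_continuity_point _ _ at_.
have [b' /andP[tb' b'b] b'E] := common_continuity_point _ _ tb.
have := tau_jump a' b'; rewrite a't ltW // => /(_ isT).
have := sigma_nd _ _ (ltW aa'); have := sigma_nd _ _ (ltW b'b); lra.
Qed.

Lemma jump_discontinuous sigma c t : 0 < c ->
  (forall a b, a < t -> t < b -> c <= sigma b - sigma a) -> ~ continuity_point sigma t.
Proof.
move=> c0 jump /cvgrPdist_lt/(_ (c / 2)).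
have c20 : 0 < c / 2 by rewrite divr_gt0.
move=> /(_ c20) near_t.
have [a [at_ sa]] : exists a, a < t /\ `|sigma t - sigma a| < c / 2.
  apply: (@filter_ex _ t^'-); apply: filterI; first exact: nbhs_left_lt.
  exact: cvg_within near_t.
have [b [tb sb]] : exists b, t < b /\ `|sigma t - sigma b| < c / 2.
  apply: (@filter_ex _ t^'+); apply: filterI; first exact: nbhs_right_gt.
  exact: cvg_within near_t.
have := jump a b at_ tb; move: sa sb; rewrite !ltr_norml; lra.
Qed.

End Jumps.

Section Representation.
Variables (R : realType) (L : {scalar growth_fun R}).
Hypothesis L_ge0 : positive_functional L.
Implicit Types (f : growth_fun R) (a b d e : R).

Lemma stieltjes_lim_cdf f a b :
  (forall e, 0 < e -> exists2 d, 0 < d & forall x y,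
    a <= x <= b -> a <= y <= b -> `|x - y| < d -> `|f x - f y| < e) ->
  stieltjes_lim f (cdf L) (fine_partitions a b) (L (window f a b)).
Proof.
move=> f_unif; apply/stieltjes_lim_fineP => e e0.
pose K := `|cdf L b - cdf L a| + 1.
have K0 : 0 < K by rewrite ltr_wpDl.
have [d d0 fd] := f_unif (e / K) (divr_gt0 e0 K0); exists d => // P Pab Pd.
have [P0 Pn P_incr P_mark] := Pab.
have -> : window f a b = window f (node P 0) (node P (part_size P)) by rewrite P0 Pn.
rewrite distrC; apply: le_lt_trans (@window_sum_le _ _ L_ge0 _ _ (mark P) _ (e / K) _ _) _.
- by move=> i iP; rewrite ltW ?P_incr.
- move=> i x iP /andP[xl xr]; have /andP[ml mr] := P_mark i iP.
  have a_node : a <= node P i by rewrite -P0 (partition_node_le Pab) ?(ltnW iP).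
  have node_b : node P i.+1 <= b by rewrite -Pn (partition_node_le Pab) ?iP ?leqnn.
  have node_d := Pd i iP.
  by apply/ltW/fd; [lra|lra|rewrite ltr_norml; lra].
rewrite P0 Pn mulrAC ltr_pdivrMr // ltr_pM2l //.
by rewrite (le_lt_trans (ler_norm _)) // ltrDl.
Qed.

Lemma horner_uniformly_continuous (p : {poly R}) a b e : 0 < e ->
  exists2 d, 0 < d & forall x y,
    a <= x <= b -> a <= y <= b -> `|x - y| < d -> `|p.[x] - p.[y]| < e.
Proof.
move=> e0; have [k k1 p_lip] := poly_lipshitz p a b.
have k0 : 0 < k by apply: lt_le_trans k1.
exists (e / k) => [|x y x_in y_in]; first by rewrite divr_gt0.
by rewrite ltr_pdivlMr // mulrC; apply: le_lt_trans; apply: p_lip; rewrite in_itv.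
Qed.

End Representation.
End StieltjesSums.

Module StieltjesMomentProblem.

Import all_boot all_order all_algebra.
Import boolp cardinality reals Rstruct.
Import Order.TTheory GRing.Theory Num.Theory.
Import PolynomialGrowth MomentFunctionals CountableSets StieltjesSums.
Set Implicit Arguments. Unset Strict Implicit. Unset Printing Implicit Defensive.
Local Notation R := Rdefinitions.R.
Local Open Scope ring_scope.

Lemma rsumE (g : nat -> R) n : rsum g n = \sum_(i < n) g i.
Proof. by elim: n => [|n IHn] /=; rewrite ?big_ord0 // big_ord_recr /= IHn. Qed.

Lemma positive_seqP (s : nat -> R) : positive_seq s <-> positive_on_squares (riesz s).
Proof.
have hankelE n c :
    rsum (fun i => rsum (fun j => c i * c j * s (i + j)%coq_nat)%R n.+1) n.+1 =
    \sum_(i < n.+1) \sum_(j < n.+1) c i * c j * s (i + j)%N.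
  by rewrite rsumE; apply: eq_bigr => i _; rewrite rsumE.
split=> [s_pos p|s_sq n c]; last first.
  apply/RleP; rewrite hankelE; have := s_sq (\poly_(i < n.+1) c i).
  rewrite (riesz_sqr _ (size_poly _ _)); congr (0 <= _).
  by apply: eq_bigr => i _; apply: eq_bigr => j _; rewrite !coef_poly !ltn_ord.
have /RleP := s_pos (size p) (fun i => p`_i).
by rewrite hankelE -riesz_sqr.
Qed.

Lemma positive_subseq (s : nat -> R) d l :
  positive_seq s -> positive_seq (fun k => s (k * d + 2 * l)%N).
Proof.
by move=> /positive_seqP s_sq; apply/positive_seqP => p; rewrite riesz_subseq_sqr.
Qed.

Lemma continuity_ptP (f : R -> R) (x : R) : continuity_pt f x <-> continuity_point f x.
Proof.
split=> [f_cont|/continuity_pointP f_cont e /RltP /f_cont[d d0 fd]].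
  apply/continuity_pointP => e e0; have /RltP/f_cont[d [/RltP d0 fd]] := e0.
  exists d => // y xy; have [<-|/eqP xy_neq] := eqVneq x y; first by rewrite subrr normr0.
  rewrite distrC; apply/RltP; rewrite -RdistE; apply: fd; split; first by split.
  by rewrite /= RdistE distrC; exact/RltP.
exists d; split; first exact/RltP.
move=> y [_ /RltP]; rewrite /= !RdistE distrC => /fd.
by rewrite distrC => ?; exact/RltP.
Qed.

Lemma same_solutionP (sigma tau : R -> R) :
  same_solution sigma tau <-> equal_up_to_constant sigma tau.
Proof.
by split=> -[k sub_k]; exists k => x /continuity_ptP; exact: sub_k.
Qed.

Section RiemannStieltjes.
Implicit Types (f sigma : R -> R) (a b I : R).

Lemma tagged_partitionP a b n p t :
  tagged_partition a b n p t <-> partitions_itv a b (MarkedPartition n p t).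
Proof.
split=> [[pa [pb [p_incr p_tag]]]|[pa pb p_incr p_tag]].
  split=> //= i /ssrnat.ltP /[dup] /p_incr/RltP // _ /p_tag[/RleP -> /RleP ->] //.
split=> //; split=> //; split=> i /ssrnat.ltP i_n; first exact/RltP/p_incr.
by have /andP[/RleP ? /RleP ?] := p_tag i i_n.
Qed.

Lemma mesh_ltP n p d t : mesh_lt n p d <-> mesh_below d (MarkedPartition n p t).
Proof. by split=> p_fine i /ssrnat.ltP i_n; apply/RltP; exact: p_fine. Qed.

Lemma RS_sumE f sigma n p t :
  RS_sum f sigma n p t = stieltjes_sum f sigma (MarkedPartition n p t).
Proof. exact: rsumE. Qed.

Lemma RS_integralP f sigma a b I : RS_integral f sigma a b I <->
  stieltjes_lim f sigma (fine_partitions a b) I.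
Proof.
split=> [f_int|/stieltjes_lim_fineP f_int].
  apply/stieltjes_lim_fineP => e /RltP /f_int[d [/RltP d0 fd]]; exists d => // -[n p t].
  move=> /tagged_partitionP Pab /mesh_ltP Pd.
  by apply/RltP; rewrite -RS_sumE -RabsE; apply: fd.
move=> e /RltP /f_int[d /RltP d0 fd]; exists d; split=> // n p t.
move=> /tagged_partitionP Pab /(mesh_ltP _ _ _ t) Pd.
by apply/RltP; rewrite RabsE RS_sumE; apply: fd.
Qed.

End RiemannStieltjes.

Section MomentSolutions.
Variable s : nat -> R.
Implicit Types (sigma tau : R -> R) (t : R).

Lemma moment_solution_represents sigma : moment_solution s sigma -> represents s sigma.
Proof.
move=> [sigma_nd moments]; split=> [x y /RleP/sigma_nd/RleP //|k].
have -> : (fun x => x ^+ k) = (fun x => pow x k) by apply/funext => x; rewrite RpowE.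
apply: stieltjes_lim_exhausting => e /RltP /(moments k)[M moment_k].
exists M => a b /RleP aM /RleP Mb; have [J [/RS_integralP J_int J_s]] := moment_k a b aM Mb.
by exists J; split=> //; apply/RltP; rewrite -RabsE.
Qed.

Lemma cdf_moment_solution (L : {scalar growth_fun R}) :
  positive_functional L -> extends L (riesz s) -> moment_solution s (cdf L).
Proof.
move=> L_ge0 L_s; split=> [x y /RleP xy|k]; first by apply/RleP; exact: cdf_nondecreasing.
pose f := poly_fun ('X^k : {poly R}).
have fE : (fun x => pow x k) = f.
  by apply/funext => x; rewrite poly_funE hornerXn RpowE.
have Lf : L f = s k by rewrite L_s rieszXn.
have [C tail] := window_tail L_ge0 f.
move=> e /RltP e0; pose M := `|C| / e + 1.
have M0 : 0 < M by rewrite ltr_wpDl // divr_ge0 // ltW.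
exists M => a b /RleP aM /RleP Mb; exists (L (window f a b)); split.
  rewrite fE; apply/RS_integralP; apply: stieltjes_lim_cdf => // d d0.
  exact: horner_uniformly_continuous.
apply/RltP; rewrite RabsE -Lf; apply: le_lt_trans (tail M a b M0 aM Mb) _.
rewrite ltr_pdivrMr // mulrDr mulr1 mulrCA divff ?gt_eqF // mulr1.
by rewrite (le_lt_trans (ler_norm _)) // ltrDl.
Qed.

Theorem hamburger : positive_seq s -> exists sigma, moment_solution s sigma.
Proof.
move=> /positive_seqP/positive_extension[L L_ge0 L_s].
by exists (cdf L); exact: cdf_moment_solution.
Qed.

Lemma determinate_discontinuous sigma t : determinate s -> moment_solution s sigma ->
  evaluation_bounded (riesz s) t -> ~ continuity_point sigma t.
Proof.
move=> [_ [_ s_unique]] sigma_s /positive_extension_atom[L [L_ge0 L_s [c c0 L_jump]]].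
have tau_s := cdf_moment_solution L_ge0 L_s.
have /same_solutionP sigma_tau := s_unique _ _ sigma_s tau_s.
apply: (jump_discontinuous c0).
apply: equal_up_to_constant_jump sigma_tau L_jump; last exact: cdf_nondecreasing.
by have [] := moment_solution_represents sigma_s.
Qed.

Lemma determinate_of_countable_bounded :
  positive_seq s -> countable (evaluation_bounded (riesz s)) -> determinate s.
Proof.
move=> s_pos bd_countable; split=> //; split=> [|sigma tau sigma_s tau_s].
  exact: hamburger.
apply/same_solutionP; apply: represents_unique bd_countable; first exact/positive_seqP.
  exact: moment_solution_represents.
exact: moment_solution_represents.
Qed.

End MomentSolutions.

(* Every [t ^ d] with [t != 0] at which evaluation is bounded is a discontinuity of the
   solution for the subsequence. *)
Lemma determinate_subseq_countable_bounded (s : nat -> R) d l : (0 < d)%N ->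
  determinate (fun k => s (k * d + 2 * l)%N) -> countable (evaluation_bounded (riesz s)).
Proof.
move=> d0 subseq_det; have [_ [[sigma sigma_s] _]] := subseq_det.
have [sigma_nd _] := moment_solution_represents sigma_s.
have jumps_countable := countable_preimage_exp d0 (countable_discontinuities sigma_nd).
apply: sub_countable (subset_card_le _) (countable_setU jumps_countable (countable1 0)).
move=> t t_bd.
have [->|t0] := eqVneq t 0; [by right|left].
exact: determinate_discontinuous subseq_det sigma_s (evaluation_bounded_subseq d l t0 t_bd).
Qed.

End StieltjesMomentProblem.

Import StieltjesMomentProblem.
Open Scope R_scope.

Theorem mainTheorem5 (s : nat -> R) (d l0 : nat) :
  positive_seq s -> (1 <= d)%nat -> Nat.Even l0 ->
  indeterminate s -> indeterminate (fun k => s (k * d + l0)%nat).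
Proof.
move=> s_pos d_ge1 [l ->] [_ s_indet]; split; first exact: positive_subseq.
move=> subseq_det; apply: s_indet.
apply: determinate_of_countable_bounded => //.
apply: determinate_subseq_countable_bounded subseq_det; exact/ssrnat.leP.
Qed.
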